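(* (Upper bounding the null maximum likelihood.) Let $\alpha\in(0,1)$, let $(P_\theta:\theta\in\Theta)$ be a collection of distributions with densities $p_\theta$ with respect to a common measure $\mu$, and let $\Theta_0\subset\Theta$. Let $Y_1,\dots,Y_{2n}$ be i.i.d. from $P_{\theta^*}$, split into two groups $D_0,D_1$ of size $n$, and let $\widehat\theta_1\in\Theta$ be any estimator constructed from $D_1$. Let $F_0$ be a relaxation of the null likelihood $\mathcal L_0$ on $\Theta_0$, i.e. a function, possibly depending on $D_0$ and possibly defined on a domain larger than $\Theta_0$, such that $$\max_{\theta}F_0(\theta)\ \ge\ \max_{\theta\in\Theta_0}\mathcal L_0(\theta),$$ and let $\widehat\theta_0^F\in\operatorname{argmax}_\theta F_0(\theta)$. Define $$T_n'=\frac{\mathcal L_0(\widehat\theta_1)}{F_0(\widehat\theta_0^F)} .$$ Then the test of $H_0:\theta^*\in\Theta_0$ that rejects when $T_n'>1/\alpha$ has type I error at most $\alpha$: $\sup_{\theta^*\in\Theta_0}P_{\theta^*}(T_n'>1/\alpha)\le\alpha$.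
   Context: The split into $D_0,D_1$ is a partition of the data indices chosen independently of the data. $\mathcal L_0(\theta)=\prod_{i\in D_0}p_\theta(Y_i)$ is the likelihood based on $D_0$. The maxima in the statement are assumed to be attained, and all quantities are assumed measurable as needed. *)

(* Defs.v *)
From HB Require Import structures.
From mathcomp Require Import all_boot all_order all_algebra.
From mathcomp Require Import all_classical all_reals all_analysis.
From mathcomp Require Import measurable_realfun.
Import Order.TTheory GRing.Theory Num.Theory.
Import numFieldNormedType.Exports.

Set Implicit Arguments.
Unset Strict Implicit.
Unset Printing Implicit Defensive.

Local Open Scope classical_set_scope.
Local Open Scope ring_scope.

Definition has_density d (X : measurableType d) (R : realType)
    (mu : {measure set X -> \bar R}) (Q : probability X R) (f : X -> R) : Prop :=
  [/\ measurable_fun setT f, forall x, 0 <= f x &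
      forall A, measurable A -> Q A = (\int[mu]_(x in A) (f x)%:E)%E].

Definition mutually_independent dO d (Om : measurableType dO)
    (X : measurableType d) (R : realType) (Pr : probability Om R) (m : nat)
    (Y : 'I_m -> {mfun Om >-> X}) : Prop :=
  forall (J : {set 'I_m}) (A : 'I_m -> set X), (forall i, measurable (A i)) ->
  Pr (\bigcap_(i in [set` J]) (Y i @^-1` A i)) =
  (\prod_(i in J) Pr (Y i @^-1` A i))%E.

Definition iid dO d (Om : measurableType dO) (X : measurableType d)
    (R : realType) (Pr : probability Om R) (m : nat)
    (Y : 'I_m -> {mfun Om >-> X}) (Q : probability X R) : Prop :=
  mutually_independent Pr Y /\
  forall i A, measurable A -> distribution Pr (Y i) A = Q A.

Definition sample dO d (Om : measurableType dO) (X : measurableType d) (m : nat)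
    (Y : 'I_m -> {mfun Om >-> X}) (w : Om) : m.-tuple X :=
  [tuple Y i w | i < m].

(* [D0 w] is the index set of the first group; the second one is [~: D0 w].
   A deterministic split is the case where [D0] is constant. *)
Definition independent_split dO d (Om : measurableType dO)
    (X : measurableType d) (R : realType) (Pr : probability Om R) (m : nat)
    (D0 : Om -> {set 'I_m}) (Y : 'I_m -> {mfun Om >-> X}) : Prop :=
  forall (s : {set 'I_m}) (B : set (m.-tuple X)), measurable B ->
  Pr (D0 @^-1` [set s] `&` sample Y @^-1` B) =
  (Pr (D0 @^-1` [set s]) * Pr (sample Y @^-1` B))%E.

(* Being a function of the observations with index in [s] is expressed, for
   functions of the whole sample, as invariance under this relation. *)
Definition agree_on (X : Type) (m : nat) (s : {set 'I_m})
    (y y' : m.-tuple X) : Prop :=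
  forall i, i \in s -> tnth y i = tnth y' i.

Definition likelihood (U X : Type) (R : realType) (p : U -> X -> R) (m : nat)
    (s : {set 'I_m}) (y : m.-tuple X) (t : U) : R :=
  \prod_(i in s) p t (tnth y i).

Definition argmax (U : Type) (R : realType) (A : set U) (f : U -> R) : set U :=
  [set t | A t /\ forall t', A t' -> f t' <= f t].

(* The quotient is taken in the extended reals, where x / 0 = +oo for x > 0 and
   0 / 0 = 0, so that a vanishing denominator with a nonzero numerator leads to
   rejection. *)
Definition Tstat (U X : Type) (R : realType) (p : U -> X -> R) (m : nat)
    (theta1 : {set 'I_m} -> m.-tuple X -> U)
    (F0 : {set 'I_m} -> m.-tuple X -> U -> R)
    (thetaF : {set 'I_m} -> m.-tuple X -> U)
    (s : {set 'I_m}) (y : m.-tuple X) : \bar R :=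
  ((likelihood p s y (theta1 s y))%:E / (F0 s y (thetaF s y))%:E)%E.

(* Main.v *)
(* Let t be the true parameter, in the null.  Since max F0 dominates L0(t), the
   event T > 1/alpha is contained in L0(theta1) > L0(t) / alpha.  Given the data
   in D1, theta1 is fixed, so L0(theta1) / L0(t) is a product of independent
   likelihood ratios, each of mean at most 1, and Markov's inequality bounds the
   conditional probability of the event by alpha.

   Only T is assumed jointly measurable in the sample, not L0(theta1), hence the
   passage to the likelihood ratio is made after conditioning on D1. *)

Require Import Defs.
From HB Require Import structures.
From mathcomp Require Import all_boot all_order all_algebra.
From mathcomp Require Import all_classical all_reals all_analysis.
From mathcomp Require Import measurable_realfun.
Import Order.TTheory GRing.Theory Num.Theory.
Import numFieldNormedType.Exports.

Set Implicit Arguments.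
Unset Strict Implicit.
Unset Printing Implicit Defensive.

Local Open Scope classical_set_scope.
Local Open Scope ring_scope.

(** * Change of measure from a law to its density *)

Section density.
Local Open Scope ereal_scope.
Context d (X : measurableType d) (R : realType).
Variables (mu : {measure set X -> \bar R}) (Q : probability X R) (f : X -> R).
Hypothesis Qf : has_density mu Q f.

Import HBNNSimple.

Let mf : measurable_fun setT f. Proof. by case: Qf. Qed.
Let f0 x : (0 <= f x)%R. Proof. by case: Qf. Qed.

Let integral_density_nnsfun (h : {nnsfun X >-> R}) :
  \int[Q]_x (h x)%:E = \int[mu]_x ((h x)%:E * (f x)%:E).
Proof.
have mEf : measurable_fun setT (EFin \o f) by exact/measurable_EFinP.
under [LHS]eq_integral do rewrite fimfunE -fsumEFin//.
under [RHS]eq_integral.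
  move=> x _; rewrite fimfunE -fsumEFin// muleC ge0_mule_fsumr; last first.
    by move=> r; rewrite EFinM nnfun_muleindic_ge0.
  over.
rewrite [LHS]ge0_integral_fsum//; last 2 first.
- by move=> r; apply/measurable_EFinP; apply: measurable_funM.
- by move=> r x _; rewrite EFinM nnfun_muleindic_ge0.
rewrite [RHS]ge0_integral_fsum//; last 2 first.
- move=> r; apply: emeasurable_funM => //.
  by apply/measurable_EFinP; apply: measurable_funM.
- by move=> r x _; rewrite mule_ge0//; [rewrite lee_fin|rewrite EFinM nnfun_muleindic_ge0].
apply: eq_fsbigr => r /[!inE] -[y _ hy].
have r0 : (0 <= r)%R by rewrite -hy.
under eq_integral do rewrite EFinM.
under [RHS]eq_integral do rewrite EFinM muleCA.
rewrite !ge0_integralZl//; last 3 first.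
- apply: emeasurable_funM => //; exact/measurable_EFinP.
- by move=> x _; rewrite mule_ge0 ?lee_fin.
- exact/measurable_EFinP.
congr (_ * _); have mr : measurable (h @^-1` [set r]) by exact: measurable_funPTI.
rewrite integral_indic// setIT.
have [_ _ QE] := Qf; apply: (etrans (QE _ mr)).
rewrite integral_mkcond; apply: eq_integral => x _.
by rewrite patchE indicE; case: ifPn => _; rewrite ?mule1 ?mule0.
Qed.

(** Simple functions reduce to their level sets, where the density formula applies; monotone
    convergence on both sides does the rest. *)
Lemma ge0_integral_density (h : X -> \bar R) :
  measurable_fun setT h -> (forall x, 0 <= h x) ->
  \int[Q]_x h x = \int[mu]_x (h x * (f x)%:E).
Proof.
move=> mh h0; pose h_ := nnsfun_approx measurableT mh.
have mEf : measurable_fun setT (EFin \o f) by exact/measurable_EFinP.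
transitivity (limn (fun n => \int[Q]_x (h_ n x)%:E)).
  rewrite -monotone_convergence//=.
  - apply: eq_integral => x _; apply/esym/cvg_lim => //=.
    exact: cvg_nnsfun_approx.
  - by move=> n; exact/measurable_EFinP.
  - by move=> n x _; rewrite lee_fin.
  - by move=> x _ m n mn; rewrite lee_fin; exact/lefP/nd_nnsfun_approx.
under eq_fun do rewrite integral_density_nnsfun.
rewrite -monotone_convergence//=.
- apply: eq_integral => x _; apply/cvg_lim => //=.
  by apply: cvgeZr => //; exact: cvg_nnsfun_approx.
- by move=> n; apply: emeasurable_funM => //; exact/measurable_EFinP.
- by move=> n x _; rewrite mule_ge0// lee_fin.
- move=> x _ m n mn; rewrite lee_pmul ?lee_fin//.
  exact/lefP/nd_nnsfun_approx.
Qed.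

End density.

(** * Likelihood ratio of a single observation *)

Section likelihood_ratio.
Local Open Scope ereal_scope.
Context d (X : measurableType d) (R : realType).
Variables (mu : {measure set X -> \bar R}) (P0 P1 : probability X R).
Variables (f0 f1 : X -> R).
Hypotheses (Pf0 : has_density mu P0 f0) (Pf1 : has_density mu P1 f1).

Lemma measurable_fun_ratio : measurable_fun setT (fun x => f1 x / f0 x)%R.
Proof.
have [mf0 f00 _] := Pf0; have [mf1 _ _] := Pf1.
(* On nonnegative reals, zero included, the inverse is the power with exponent -1, a measurable
   function. *)
under eq_fun do rewrite -powR_inv1//.
apply: measurable_funM => //.
exact: (measurableT_comp (measurable_powR (- 1)) mf0).
Qed.

(* The inequality may be strict, as [P1] may charge the set where [f0]
   vanishes. *)
Lemma integral_ratio_le1 : \int[P0]_x (f1 x / f0 x)%:E <= 1.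
Proof.
have [mf0 f00 _] := Pf0; have [mf1 f10 P1E] := Pf1.
rewrite (ge0_integral_density Pf0); last 2 first.
- exact/measurable_EFinP/measurable_fun_ratio.
- by move=> x; rewrite lee_fin divr_ge0.
rewrite -(probability_setT P1) P1E//; apply: ge0_le_integral => //.
- by move=> x _; rewrite mule_ge0 ?lee_fin// divr_ge0.
- apply: emeasurable_funM; apply/measurable_EFinP => //.
  exact: measurable_fun_ratio.
- exact/measurable_EFinP.
move=> x _; rewrite -EFinM lee_fin.
(* Where [f0] vanishes the left side is 0; elsewhere the ratio times [f0] is exactly [f1]. *)
by have [->|f0x] := eqVneq (f0 x) 0%R; rewrite ?mulr0// divfK.
Qed.

(** Makes the true likelihood almost surely nonzero, so that dividing by it is harmless. *)
Lemma density_vanishing0 : P0 [set x | f0 x = 0%R] = 0.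
Proof.
have [mf0 _ P0E] := Pf0.
rewrite P0E; last first.
  rewrite -[X in measurable X]setTI.
  exact: (mf0 measurableT [set 0%R] (measurable_set1 _)).
by apply: integral0_eq => x /= ->.
Qed.

End likelihood_ratio.

(** * Product laws on tuples and resampling of coordinates *)

Definition box (X : Type) m (A : 'I_m -> set X) : set (m.-tuple X) :=
  [set y | forall i, A i (tnth y i)].

Section tuple_law.
Context d (X : measurableType d) (R : realType) (m : nat).
Implicit Types (A : 'I_m -> set X) (s : {set 'I_m}).

Lemma measurable_box A : (forall i, measurable (A i)) -> measurable (box A).
Proof.
move=> mA; rewrite (_ : box A = \bigcap_(i in setT) ((@tnth _ X)^~ i @^-1` A i)).
  apply: fin_bigcap_measurable => // i _.
  by rewrite -[X in measurable X]setTI; exact: measurable_tnth.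
by apply/seteqP; split=> [y yA i _|y yA i]; apply: yA.
Qed.

Lemma measurable_prod_tnth s (g : X -> R) : measurable_fun setT g ->
  measurable_fun setT (fun y : m.-tuple X => \prod_(i in s) g (tnth y i)).
Proof.
move=> mg; under eq_fun do rewrite big_mkcond/=.
apply: measurable_prod => i _; case: (i \in s) => //.
exact: (measurableT_comp mg (measurable_tnth i)).
Qed.

(** Measurable boxes are closed under intersection and generate the sigma-algebra of tuples, so they
    determine a finite measure. *)
Lemma measure_box_unique (m1 m2 : {measure set (m.-tuple X) -> \bar R}) :
  (m1 setT < +oo)%E ->
  (forall A, (forall i, measurable (A i)) -> m1 (box A) = m2 (box A)) ->
  forall B, measurable B -> m1 B = m2 B.
Proof.
move=> m1oo m12; pose G := [set box A | A in [set A : 'I_m -> set X | forall i, measurable (A i)]].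
apply: (measure_unique G (fun=> setT)).
- apply/seteqP; split; last first.
    apply: smallest_sub; first exact: sigma_algebra_measurable.
    by move=> _ [A mA <-]; exact: measurable_box.
  apply: smallest_sub; first exact: smallest_sigma_algebra.
  move=> B; rewrite -bigcup_seq => -[i /= _ [C mC <-]]; rewrite setTI.
  apply: sub_sigma_algebra.
  (* A constraint on coordinate [i] alone is a box whose other sides are full. *)
  exists (fun j => if j == i then C else setT) => [j /=|].
    by case: ifPn.
  apply/seteqP; split=> [y /(_ i)|y Cy j]; first by rewrite eqxx.
  by case: ifPn => // /eqP ->.
- move=> _ _ [A mA <-] [A' mA' <-]; exists (fun i => A i `&` A' i) => [i /=|].
    exact: measurableI.
  apply/seteqP; split=> [y yA|y [yA yA'] i]; last by split.
  by split=> i; have [] := yA i.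
- move=> _; exists (fun=> setT) => //.
  by apply/seteqP; split.
- by rewrite bigcup_const.
- by move=> _ [A mA <-]; exact: m12.
- by [].
Qed.

Definition merge s (yy : m.-tuple X * m.-tuple X) : m.-tuple X :=
  [tuple if i \in s then tnth yy.2 i else tnth yy.1 i | i < m].

Lemma tnth_merge s yy i :
  tnth (merge s yy) i = if i \in s then tnth yy.2 i else tnth yy.1 i.
Proof. by rewrite tnth_mktuple. Qed.

Lemma measurable_merge s : measurable_fun setT (merge s).
Proof.
apply/measurable_fun_tnthP => i; rewrite /comp.
under eq_fun do rewrite tnth_merge.
by case: (i \in s); [apply: (measurableT_comp (measurable_tnth i) measurable_snd)
  |apply: (measurableT_comp (measurable_tnth i) measurable_fst)].
Qed.

Variables (P : probability X R) (Q : probability (m.-tuple X) R).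
Hypothesis QP : forall A, (forall i, measurable (A i)) ->
  Q (box A) = (\prod_(i < m) P (A i))%E.

(* This gives Fubini's theorem for the splitting of the coordinates into [s] and
   [~: s] without having to construct product measures over [s] and [~: s]. *)
Lemma merge_law s B : measurable B -> (Q \x Q)%E (merge s @^-1` B) = Q B.
Proof.
move: B; pose mm : {mfun _ >-> _} :=
  HB.pack (merge s) (isMeasurableFun.Build _ _ _ _ _ (measurable_merge s)).
apply: (@measure_box_unique (pushforward (Q \x Q)%E mm) Q).
  rewrite /= /pushforward preimage_setT -setXTT product_measure1E//.
  rewrite (_ : _ * _ = 1)%E ?ltry// -[RHS]mule1.
  by congr (_ * _)%E; exact: probability_setT.
move=> A mA; rewrite /= /pushforward.
(* The constraints outside [s] bear on the first copy and those in [s] on the second, so the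
   preimage of a box is a rectangle. For each [i], one of the two sides is full and contributes a
   factor 1. *)
pose A1 i := if i \in s then setT else A i.
pose A2 i := if i \in s then A i else setT.
have mA1 i : measurable (A1 i) by rewrite /A1; case: ifPn.
have mA2 i : measurable (A2 i) by rewrite /A2; case: ifPn.
rewrite (_ : merge s @^-1` box A = box A1 `*` box A2); last first.
  apply/seteqP; split=> [[y1 y2] /= yA|[y1 y2] [/= yA1 yA2] i].
    by split=> i /=; have := yA i; rewrite tnth_merge/= /A1 /A2; case: ifPn.
  by have := yA1 i; have := yA2 i; rewrite tnth_merge /A1 /A2/=; case: ifPn.
rewrite product_measure1E; [|exact: measurable_box..].
rewrite [RHS]QP//; apply: (etrans (congr2 mule (QP mA1) (QP mA2))).
rewrite -big_split/=; apply: eq_bigr => i _; rewrite /A1 /A2.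
by case: ifPn => _; rewrite probability_setT ?mul1e ?mule1.
Qed.

Lemma ge0_integral_merge s (h : m.-tuple X -> \bar R) :
  measurable_fun setT h -> (forall y, 0 <= h y)%E ->
  (\int[Q]_y h y = \int[Q \x Q]_yy h (merge s yy))%E.
Proof.
move=> mh h0.
rewrite -(ge0_integral_pushforward (measurable_merge s) _ measurableT)//.
apply/esym; apply: eq_measure_integral => [|? A mA _]; first exact: measurable_merge.
exact: merge_law.
Qed.

Lemma tnth_law i C : measurable C -> Q [set y | C (tnth y i)] = P C.
Proof.
move=> mC; pose A j := if j == i then C else setT.
rewrite (_ : [set y | _] = box A); last first.
  apply/seteqP; split=> [y Cy j|y /(_ i)]; rewrite /A ?eqxx//.
  by case: ifPn => // /eqP ->.
rewrite QP; last by move=> j; rewrite /A; case: ifPn.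
rewrite (bigD1 i)//= /A eqxx big1 ?mule1// => j /negbTE ->.
exact: probability_setT.
Qed.

Lemma ge0_integral_tnth i (h : X -> \bar R) :
  measurable_fun setT h -> (forall x, 0 <= h x)%E ->
  (\int[Q]_y h (tnth y i) = \int[P]_x h x)%E.
Proof.
move=> mh h0.
rewrite -(ge0_integral_pushforward (measurable_tnth i) Q measurableT)//.
apply: eq_measure_integral => [|? A mA _]; first exact: measurable_tnth.
exact: tnth_law.
Qed.

(** Induction on the size of [s]: one coordinate is resampled independently and integrated out,
    which costs a factor at most 1. *)
Lemma integral_prod_le1 s (g : X -> R) : measurable_fun setT g ->
  (forall x, 0 <= g x) -> (\int[P]_x (g x)%:E <= 1)%E ->
  (\int[Q]_y (\prod_(i in s) g (tnth y i))%:E <= 1)%E.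
Proof.
move=> mg g0 Pg.
have mgt i : measurable_fun setT (fun y : m.-tuple X => g (tnth y i)).
  exact: (measurableT_comp mg (measurable_tnth i)).
have mpr s' : measurable_fun setT
    (fun y : m.-tuple X => (\prod_(i in s') g (tnth y i))%:E).
  by apply/measurable_EFinP; exact: measurable_prod_tnth.
have pr0 s' (y : m.-tuple X) : (0 <= (\prod_(i in s') g (tnth y i))%:E)%E.
  by rewrite lee_fin prodr_ge0.
have [k] := ubnP #|s|; elim: k => // k IH in s *.
rewrite ltnS => sk; have [->|[i is_]] := set_0Vmem s.
  under eq_integral do rewrite big_set0.
  by rewrite integral_cst// mul1e; exact: probability_le1.
have /IH {}IH : (#|s :\ i| < k)%N by rewrite (cardsD1 i) is_ in sk.
(* Only the factor at [i] reads the second copy, so the inner Tonelli integral is the remaining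
   product times the mean of [g]. *)
pose H (yy : m.-tuple X * m.-tuple X) :=
  ((\prod_(j in s :\ i) g (tnth yy.1 j))%:E * (g (tnth yy.2 i))%:E)%E.
have mH : measurable_fun setT H.
  apply: emeasurable_funM.
    exact: (measurableT_comp (mpr _) measurable_fst).
  apply/measurable_EFinP.
  exact: (measurableT_comp (mgt i) measurable_snd).
have H0 yy : (0 <= H yy)%E by rewrite mule_ge0 ?lee_fin ?prodr_ge0.
rewrite (ge0_integral_merge [set i])//.
rewrite (_ : (fun _ => _) = H); last first.
  apply/funext => yy; rewrite /= (big_setD1 i)//= tnth_merge inE eqxx.
  rewrite mulrC EFinM; congr (_%:E * _)%E; apply: eq_bigr => j.
  by rewrite tnth_merge !inE => /andP[/negbTE ->].
rewrite fubini_tonelli1//.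
apply: le_trans IH; apply: ge0_le_integral => //.
- by move=> y _; apply: integral_ge0 => y' _; exact: H0.
- exact: measurable_fun_fubini_tonelli_F.
have mEg : measurable_fun setT (EFin \o g) by exact/measurable_EFinP.
move=> y _; rewrite /fubini_F /H /= ge0_integralZl//; last 2 first.
- exact: (measurableT_comp mEg (measurable_tnth i)).
- by move=> y' _; rewrite lee_fin.
rewrite (ge0_integral_tnth i mEg); last by move=> x; rewrite /= lee_fin.
by rewrite -[leRHS]mule1 lee_wpmul2l.
Qed.

End tuple_law.

(** * Rejection thresholds and Markov's inequality for product likelihoods *)

Lemma lt_mul_of_lt_dive (R : realType) (c l a b : R) : 0 < c -> 0 <= l <= b ->
  (c%:E < a%:E / b%:E)%E -> c * l < a.
Proof.
move=> c0 /andP[l0 lb]; have [b0|b0] := eqVneq b 0.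
  (* If [b] is zero then so is [l], and the quotient is [a] times [+oo], which exceeds the positive
     [c] only when [a] is positive. *)
  have -> : l = 0 by apply/eqP; rewrite eq_le l0 -b0 lb.
  rewrite mulr0 b0 inve0; have [//|a0 ca] := ltP 0 a; exfalso.
  have /(lt_le_trans ca) : (a%:E * +oo <= 0)%E by rewrite mule_le0_ge0 ?lee_fin.
  by rewrite lte_fin ltNge (ltW c0).
have b_gt0 : 0 < b by rewrite lt_neqAle eq_sym b0 (le_trans l0 lb).
rewrite inver (negbTE b0) -EFinM lte_fin ltr_pdivlMr//.
by apply: le_lt_trans; rewrite ler_pM2l.
Qed.

Section product_likelihood.
Context d (X : measurableType d) (R : realType) (m : nat).
Variables (mu : {measure set X -> \bar R}) (P0 P1 : probability X R).
Variables (f0 f1 : X -> R).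
Hypotheses (Pf0 : has_density mu P0 f0) (Pf1 : has_density mu P1 f1).
Variable Q : probability (m.-tuple X) R.
Hypothesis QP0 : forall A : 'I_m -> set X, (forall i, measurable (A i)) ->
  Q (box A) = (\prod_(i < m) P0 (A i))%E.

Lemma measurable_likelihood_gt (s : {set 'I_m}) (c : R) :
  measurable [set y : m.-tuple X |
    c * \prod_(i in s) f0 (tnth y i) < \prod_(i in s) f1 (tnth y i)].
Proof.
have [mf0 _ _] := Pf0; have [mf1 _ _] := Pf1.
have : measurable_fun setT (fun y : m.-tuple X =>
    c * \prod_(i in s) f0 (tnth y i) < \prod_(i in s) f1 (tnth y i)).
  apply: measurable_fun_ltr; first apply: measurable_funM => //.
    exact: measurable_prod_tnth.
  exact: measurable_prod_tnth.
by move=> /(_ measurableT [set true]); rewrite setTI; exact.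
Qed.

(** Markov's inequality for the product of ratios. Samples where some [f0] vanishes are set aside as
    a null event: the ratio defaults to 0 there, although the likelihood inequality may hold. *)
Lemma prob_likelihood_gt (s : {set 'I_m}) (c : R) : 0 < c ->
  (Q [set y | (c * \prod_(i in s) f0 (tnth y i) <
               \prod_(i in s) f1 (tnth y i))%R]
   <= (c^-1)%:E)%E.
Proof.
move=> c0; have [mf0 f00 _] := Pf0; have [mf1 f10 _] := Pf1.
pose g x := f1 x / f0 x; have mg : measurable_fun setT g := measurable_fun_ratio Pf0 Pf1.
have g0 x : 0 <= g x by rewrite divr_ge0.
pose G := [set y : m.-tuple X |
  (c%:E <= `|(\prod_(i in s) g (tnth y i))%:E|)%E].
have mEg : measurable_fun setT (fun y : m.-tuple X => (\prod_(i in s) g (tnth y i))%:E).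
  by apply/measurable_EFinP; exact: measurable_prod_tnth.
have mG : measurable G.
  rewrite -[G]setTI; apply: emeasurable_fun_c_infty => //.
  exact: measurableT_comp.
have QG : (Q G <= (c^-1)%:E)%E.
  have := @le_integral_abse _ _ _ Q setT measurableT _ c mEg c0.
  rewrite setTI -/G => /le_trans QG.
  rewrite -[leRHS]mule1 lee_pdivlMl//.
  apply: QG; under eq_integral do rewrite gee0_abs ?lee_fin ?prodr_ge0//.
  exact: (integral_prod_le1 QP0 s mg g0 (integral_ratio_le1 Pf0 Pf1)).
pose A (_ : 'I_m) := [set x | f0 x != 0].
have mA0 : measurable [set x | f0 x = 0].
  rewrite -[X in measurable X]setTI.
  exact: (mf0 measurableT [set 0] (measurable_set1 _)).
have A_E i : A i = ~` [set x | f0 x = 0].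
  by apply/seteqP; split=> x /= /eqP.
have mA i : measurable (A i) by rewrite A_E; exact: measurableC.
have mbA : measurable (~` box A) by apply: measurableC; exact: measurable_box.
have QA : Q (~` box A) = 0%E.
  rewrite probability_setC; last exact: measurable_box.
  rewrite QP0// big1 ?subee// => i _.
  by rewrite A_E probability_setC// (density_vanishing0 Pf0) sube0.
apply: (@le_trans _ _ (Q (~` box A `|` G))).
  apply: le_measure; rewrite ?inE.
  - exact: measurable_likelihood_gt.
  - exact: measurableU.
  move=> y /= lt01; have [yA|] := pselect (box A y); [right|by left].
  rewrite /G /= lee_fin ger0_norm ?prodr_ge0// prodf_div ler_pdivlMr.
    exact: ltW.
  by apply: prodr_gt0 => i _; rewrite lt_neqAle f00 eq_sym yA.
apply: le_trans (measureU2 _ mbA mG) _.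
by rewrite [X in (X + _)%E]QA add0e.
Qed.

End product_likelihood.

(** * Law of the sample and averaging over the random split *)

Section sample.
Context dO d (Om : measurableType dO) (X : measurableType d) (R : realType).
Context (Pr : probability Om R) (m : nat) (Y : 'I_m -> {mfun Om >-> X}).

Lemma measurable_sample : measurable_fun setT (sample Y).
Proof.
apply/measurable_fun_tnthP => i.
by rewrite (_ : _ \o _ = Y i)//; apply/funext => w; rewrite /= tnth_mktuple.
Qed.

HB.instance Definition _ :=
  isMeasurableFun.Build _ _ _ _ (sample Y) measurable_sample.

Lemma sample_law_box (P : probability X R) : iid Pr Y P ->
  forall A : 'I_m -> set X, (forall i, measurable (A i)) ->
  distribution Pr (sample Y) (box A) = (\prod_(i < m) P (A i))%E.
Proof.
move=> [indY YP] A mA; rewrite /distribution /pushforward.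
have := indY [set: 'I_m]%SET A mA.
rewrite (_ : \bigcap_(i in _) _ = sample Y @^-1` box A); last first.
  apply/seteqP; split=> [w wA i|w wA i _].
    by rewrite tnth_mktuple; apply: wA => /=; rewrite inE.
  by have := wA i; rewrite tnth_mktuple.
move=> ->; apply: eq_big => [i|i _]; first by rewrite inE.
exact: YP.
Qed.

(** By independence, the event restricted to [D0 = s] has probability at most [a] times that of
    [D0 = s]; these weights sum to 1 over the finitely many [s]. *)
Lemma independent_split_le (D0 : Om -> {set 'I_m})
    (B : {set 'I_m} -> set (m.-tuple X)) (a : R) :
  (forall s, measurable (D0 @^-1` [set s])) -> independent_split Pr D0 Y ->
  (forall w, measurable (B (D0 w))) ->
  (forall w, (distribution Pr (sample Y) (B (D0 w)) <= a%:E)%E) ->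
  (Pr [set w | B (D0 w) (sample Y w)] <= a%:E)%E.
Proof.
move=> mD indD mB Ba; pose F s := D0 @^-1` [set s] `&` sample Y @^-1` (B s).
(* The assumptions on [B] concern attained splits only; any other [s] has an empty slice. *)
have D0_or s : D0 @^-1` [set s] = set0 \/ exists w, D0 w = s.
  have [|Ds] := pselect (exists w, D0 w = s); first by right.
  by left; apply/seteqP; split=> // w /= Dw; apply: Ds; exists w.
have tD : trivIset setT (fun s => D0 @^-1` [set s]).
  by apply/trivIsetP => s1 s2 _ _ s12; apply/seteqP; split=> // w [/= -> /eqP];
    rewrite (negbTE s12).
have mF s : measurable (F s).
  rewrite /F; have [->|[w <-]] := D0_or s; first by rewrite set0I.
  apply: measurableI => //; rewrite -[X in measurable X]setTI.
  exact: measurable_sample.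
have Fa s : (Pr (F s) <= a%:E * Pr (D0 @^-1` [set s]))%E.
  rewrite /F; have [->|[w <-]] := D0_or s; first by rewrite set0I measure0 mule0.
  by rewrite indD// muleC lee_wpmul2r//; exact: Ba.
rewrite (_ : [set w | _] = \bigcup_(s in setT) F s); last first.
  by apply/seteqP; split=> [w Bw|w [s _] [/= -> //]]; exists (D0 w).
have finT : finite_set [set: {set 'I_m}] by [].
rewrite measure_fin_bigcup//; last exact: trivIset_setIr.
have D0T : \bigcup_(s in setT) D0 @^-1` [set s] = setT.
  by apply/seteqP; split=> // w _; exists (D0 w).
have : (\sum_(s \in setT) Pr (D0 @^-1` [set s]) = 1)%E.
  rewrite -measure_fin_bigcup// D0T; exact: probability_setT.
move=> D1; rewrite -[leRHS]mule1 -D1 ge0_mule_fsumr//.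
by apply: lee_fsum => // s _; exact: Fa.
Qed.

End sample.

Theorem mainTheorem4 (R : realType) (alpha : R) (halpha : 0 < alpha < 1)
  (d : measure_display) (X : measurableType d) (mu : {measure set X -> \bar R})
  (* ambient parameter space U, model Theta, null Theta0, domain DF of F0 *)
  (U : Type) (Theta Theta0 DF : set U)
  (hTheta0 : Theta0 `<=` Theta) (hDF : Theta0 `<=` DF)
  (P : U -> probability X R) (p : U -> X -> R)
  (hp : forall t, Theta t -> has_density mu (P t) (p t))
  (* data Y and split D0 on a sample space with law Pr t when theta^* = t *)
  (n : nat) (dO : measure_display) (Om : measurableType dO)
  (Pr : U -> probability Om R)
  (Y : 'I_(2 * n) -> {mfun Om >-> X})
  (hY : forall t, Theta t -> iid (Pr t) Y (P t))
  (D0 : Om -> {set 'I_(2 * n)})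
  (hD0card : forall w, #|D0 w| = n)
  (hD0meas : forall s, measurable (D0 @^-1` [set s]))
  (hD0ind : forall t, Theta t -> independent_split (Pr t) D0 Y)
  (* estimator constructed from D1 *)
  (theta1 : {set 'I_(2 * n)} -> (2 * n).-tuple X -> U)
  (htheta1 : forall (s : {set 'I_(2 * n)}) y, #|s| = n -> Theta (theta1 s y))
  (htheta1D1 : forall (s : {set 'I_(2 * n)}) y y', #|s| = n -> agree_on (~: s) y y' ->
     theta1 s y = theta1 s y')
  (* relaxation of the null likelihood, depending on D0 only *)
  (F0 : {set 'I_(2 * n)} -> (2 * n).-tuple X -> U -> R)
  (hF0D0 : forall (s : {set 'I_(2 * n)}) y y', #|s| = n -> agree_on s y y' ->
     forall t, DF t -> F0 s y t = F0 s y' t)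
  (thetaF : {set 'I_(2 * n)} -> (2 * n).-tuple X -> U)
  (hLmax : forall (s : {set 'I_(2 * n)}) y, #|s| = n -> argmax Theta0 (likelihood p s y) !=set0)
  (hthetaF : forall (s : {set 'I_(2 * n)}) y, #|s| = n -> argmax DF (F0 s y) (thetaF s y))
  (hrelax : forall (s : {set 'I_(2 * n)}) y, #|s| = n ->
     sup (likelihood p s y @` Theta0) <= sup (F0 s y @` DF))
  (hTmeas : forall (s : {set 'I_(2 * n)}), #|s| = n ->
     measurable_fun setT (Tstat p theta1 F0 thetaF s)) :
  (ereal_sup [set Pr t [set w | (alpha^-1)%:E <
       Tstat p theta1 F0 thetaF (D0 w) (sample Y w)] | t in Theta0]
   <= alpha%:E)%E.
Proof.
have /andP[a0 _] := halpha; have c0 : 0 < alpha^-1 by rewrite invr_gt0.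
apply: ge_ereal_sup => _ [t Tt <-].
have Th_t := hTheta0 _ Tt.
pose Q : probability ((2 * n).-tuple X) R := distribution (Pr t) (sample Y).
have QP (A : 'I_(2 * n) -> set X) : (forall i, measurable (A i)) ->
    Q (box A) = (\prod_(i < 2 * n) P t (A i))%E.
  exact: sample_law_box (hY _ Th_t) _.
pose B s := [set y | ((alpha^-1)%:E < Tstat p theta1 F0 thetaF s y)%E].
have mB (s : {set 'I_(2 * n)}) : #|s| = n -> measurable (B s).
  move=> sn; rewrite -[X in measurable X]setTI.
  by apply: emeasurable_fun_o_infty => //; exact: hTmeas.
apply: (independent_split_le (B := B) hD0meas (hD0ind _ Th_t)) => w.
  exact: mB.
move: (D0 w) (hD0card w) => s sn {w}.
(* The data in [s] are replaced by an independent copy, so the probability becomes an integral over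
   the first copy of the measures of its sections. *)
rewrite -[leLHS](merge_law QP s (mB _ sn)).
have mmB : measurable (merge s @^-1` B s).
  by rewrite -[X in measurable X]setTI; apply: measurable_merge => //; exact: mB.
rewrite /product_measure1.
apply: (@le_trans _ _ (\int[Q]_y' alpha%:E)%E); last first.
  rewrite integral_cst// -[leRHS]mule1 lee_wpmul2l ?lee_fin ?(ltW a0)//.
  exact: probability_le1.
apply: ge0_le_integral => //.
- exact: measurable_fun_xsection.
move=> y' _ /=.
(* The first component [y'] carries the data in [~: s]: once it is fixed, so is
   the estimator. *)
pose t1 := theta1 s y'.
have Th1 : Theta t1 by exact: htheta1.
have := prob_likelihood_gt (hp _ Th_t) (hp _ Th1) QP s c0; rewrite invrK.
apply: le_trans.
apply: le_measure; rewrite ?inE.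
- exact: measurable_xsection.
- exact: (measurable_likelihood_gt (hp _ Th_t) (hp _ Th1)).
move=> y /xsectionP /=; set z := merge s (y', y) => Tz.
(* The merged sample agrees with [y'] off [s], the only data the estimator sees. *)
have z1 : theta1 s z = t1.
  by apply: htheta1D1 => // i; rewrite inE tnth_merge => /negbTE ->.
have Lz u : \prod_(i in s) p u (tnth y i) = likelihood p s z u.
  by apply: eq_bigr => i si; rewrite tnth_merge si.
rewrite !Lz -z1; apply: (lt_mul_of_lt_dive c0 _ Tz); apply/andP; split.
  by apply: prodr_ge0 => i _; have [_ ->] := hp _ Th_t.
have [_ Fmax] := hthetaF _ z sn.
(* The maximizer [u] bounds the set of null likelihoods above, so that [sup] really dominates the
   value at [t]. *)
have [u [_ Lmax]] := hLmax _ z sn.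
apply: (@le_trans _ _ (sup (likelihood p s z @` Theta0))).
  by apply: ub_le_sup; [exists (likelihood p s z u) => _ [v /Lmax lv <-]|exists t].
apply: (le_trans (hrelax _ z sn)); apply: ge_sup.
  (* The null parameter [t] also lies in [DF], so the set of values of [F0] is nonempty, as bounding
     its [sup] requires. *)
  by exists (F0 s z t), t => //; exact: hDF.
by move=> _ [v /Fmax Fv <-].
Qed.
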